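(* Let $C$ be the Gentzen calculus consisting of Cut, Weakening, Contraction, and the elimination rules for all connectives and constants. Then the Identity rule is antiadmissible in $C$: for every set $S$ of sequents, if the empty sequent $\emptyset\vartriangleright\emptyset$ is derivable from $S$ in $C$ extended by Identity, then it is derivable from $S$ in $C$.
   Context: Formulas are built from atoms using $\wedge,\vee,{-},\top,\bot$; a sequent $\Gamma\vartriangleright\Delta$ is a pair of finite multisets of formulas. Elimination rules: from $\Gamma\vartriangleright\Delta,\varphi\wedge\psi$ infer $\Gamma\vartriangleright\Delta,\varphi$, and infer $\Gamma\vartriangleright\Delta,\psi$; from $\varphi\wedge\psi,\Gamma\vartriangleright\Delta$ infer $\varphi,\psi,\Gamma\vartriangleright\Delta$; from $\varphi\vee\psi,\Gamma\vartriangleright\Delta$ infer $\varphi,\Gamma\vartriangleright\Delta$, and infer $\psi,\Gamma\vartriangleright\Delta$; from $\Gamma\vartriangleright\Delta,\varphi\vee\psi$ infer $\Gamma\vartriangleright\Delta,\varphi,\psi$; from $\Gamma\vartriangleright\Delta,{-}\varphi$ infer $\varphi,\Gamma\vartriangleright\Delta$; from ${-}\varphi,\Gamma\vartriangleright\Delta$ infer $\Gamma\vartriangleright\Delta,\varphi$; from $\top,\Gamma\vartriangleright\Delta$ infer $\Gamma\vartriangleright\Delta$; from $\Gamma\vartriangleright\Delta,\bot$ infer $\Gamma\vartriangleright\Delta$. Weakening: from $\Gamma\vartriangleright\Delta$ infer $\varphi,\Gamma\vartriangleright\Delta$ and $\Gamma\vartriangleright\Delta,\varphi$. Contraction: from $\varphi,\varphi,\Gamma\vartriangleright\Delta$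 infer $\varphi,\Gamma\vartriangleright\Delta$; from $\Gamma\vartriangleright\Delta,\varphi,\varphi$ infer $\Gamma\vartriangleright\Delta,\varphi$. Cut: from $\Gamma\vartriangleright\Delta,\varphi$ and $\varphi,\Gamma'\vartriangleright\Delta'$ infer $\Gamma,\Gamma'\vartriangleright\Delta,\Delta'$. Identity: the axiom $\varphi\vartriangleright\varphi$. All rules apply to arbitrary formulas and finite multisets. *)

(* Defs.v *)
From HB Require Import structures.
From mathcomp Require Import all_boot.
From mathcomp Require Import finmap multiset.

Set Implicit Arguments.
Unset Strict Implicit.
Unset Printing Implicit Defensive.

Local Open Scope mset_scope.

Inductive form (A : Type) : Type :=
| Atom of A
| And of form A & form A
| Or of form A & form A
| Neg of form A
| Top
| Bot.

Arguments Top {A}.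
Arguments Bot {A}.

(* {mset T} requires a choiceType; the instance on formulas is transported
   from GenTree.tree. *)
Fixpoint form_encode (A : Type) (f : form A) : GenTree.tree A :=
  match f with
  | Atom a => GenTree.Leaf a
  | And f g => GenTree.Node 0 [:: form_encode f; form_encode g]
  | Or f g => GenTree.Node 1 [:: form_encode f; form_encode g]
  | Neg f => GenTree.Node 2 [:: form_encode f]
  | Top => GenTree.Node 3 [::]
  | Bot => GenTree.Node 4 [::]
  end.

Fixpoint form_decode (A : Type) (t : GenTree.tree A) : form A :=
  match t with
  | GenTree.Leaf a => Atom a
  | GenTree.Node 0 [:: t; u] => And (form_decode t) (form_decode u)
  | GenTree.Node 1 [:: t; u] => Or (form_decode t) (form_decode u)
  | GenTree.Node 2 [:: t] => Neg (form_decode t)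
  | GenTree.Node 3 _ => Top
  | _ => Bot
  end.

Lemma form_encodeK (A : Type) : cancel (@form_encode A) (@form_decode A).
Proof. by elim=> //= [f -> g ->|f -> g ->|f ->]. Qed.

HB.instance Definition _ (A : choiceType) :=
  Choice.copy (form A) (can_type (@form_encodeK A)).

Definition sequent (A : choiceType) : Type := ({mset form A} * {mset form A})%type.

Notation "G |> D" := ((G, D) : sequent _) (at level 70, no associativity).

(* A rule is the set of its instances: a list of premises and a conclusion.
   A calculus, being a union of rules, has the same type. *)
Definition rule (A : choiceType) : Type := seq (sequent A) -> sequent A -> Prop.

Definition rule_union (A : choiceType) (R1 R2 : rule A) : rule A :=
  fun ps c => R1 ps c \/ R2 ps c.

Inductive derivable (A : choiceType) (C : rule A) (S : sequent A -> Prop) :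
    sequent A -> Prop :=
| derivable_hyp s : S s -> derivable C S s
| derivable_rule ps c :
    C ps c -> (forall p, p \in ps -> derivable C S p) -> derivable C S c.

Definition empty_sequent (A : choiceType) : sequent A := mset0 |> mset0.

Arguments empty_sequent : clear implicits.

Definition antiadmissible (A : choiceType) (R C : rule A) : Prop :=
  forall S : sequent A -> Prop,
    derivable (rule_union C R) S (empty_sequent A) ->
    derivable C S (empty_sequent A).

Inductive elimination_rule (A : choiceType) : rule A :=
| elim_andR1 (G D : {mset form A}) (f g : form A) :
    elimination_rule [:: G |> And f g +` D] (G |> f +` D)
| elim_andR2 (G D : {mset form A}) (f g : form A) :
    elimination_rule [:: G |> And f g +` D] (G |> g +` D)
| elim_andL (G D : {mset form A}) (f g : form A) :
    elimination_rule [:: And f g +` G |> D] (f +` (g +` G) |> D)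
| elim_orL1 (G D : {mset form A}) (f g : form A) :
    elimination_rule [:: Or f g +` G |> D] (f +` G |> D)
| elim_orL2 (G D : {mset form A}) (f g : form A) :
    elimination_rule [:: Or f g +` G |> D] (g +` G |> D)
| elim_orR (G D : {mset form A}) (f g : form A) :
    elimination_rule [:: G |> Or f g +` D] (G |> f +` (g +` D))
| elim_negR (G D : {mset form A}) (f : form A) :
    elimination_rule [:: G |> Neg f +` D] (f +` G |> D)
| elim_negL (G D : {mset form A}) (f : form A) :
    elimination_rule [:: Neg f +` G |> D] (G |> f +` D)
| elim_topL (G D : {mset form A}) :
    elimination_rule [:: Top +` G |> D] (G |> D)
| elim_botR (G D : {mset form A}) :
    elimination_rule [:: G |> Bot +` D] (G |> D).

Inductive weakening_rule (A : choiceType) : rule A :=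
| weakL (G D : {mset form A}) (f : form A) :
    weakening_rule [:: G |> D] (f +` G |> D)
| weakR (G D : {mset form A}) (f : form A) :
    weakening_rule [:: G |> D] (G |> f +` D).

Inductive contraction_rule (A : choiceType) : rule A :=
| contrL (G D : {mset form A}) (f : form A) :
    contraction_rule [:: f +` (f +` G) |> D] (f +` G |> D)
| contrR (G D : {mset form A}) (f : form A) :
    contraction_rule [:: G |> f +` (f +` D)] (G |> f +` D).

Inductive cut_rule (A : choiceType) : rule A :=
| Cut (G D G' D' : {mset form A}) (f : form A) :
    cut_rule [:: G |> f +` D; f +` G' |> D'] (G `+` G' |> D `+` D').

Inductive identity_rule (A : choiceType) : rule A :=
| Identity (f : form A) :
    identity_rule [::] ([mset f] |> [mset f]).

Arguments elimination_rule : clear implicits.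
Arguments weakening_rule : clear implicits.
Arguments contraction_rule : clear implicits.
Arguments cut_rule : clear implicits.
Arguments identity_rule : clear implicits.

Definition elimination_calculus (A : choiceType) : rule A :=
  rule_union (cut_rule A)
    (rule_union (weakening_rule A)
      (rule_union (contraction_rule A) (elimination_rule A))).

Arguments elimination_calculus : clear implicits.

(* Main.v *)
Require Import Defs.
From mathcomp Require Import all_boot.
From mathcomp Require Import finmap multiset.

Set Implicit Arguments.
Unset Strict Implicit.
Unset Printing Implicit Defensive.

Local Open Scope mset_scope.

(** A pair [(l, r)] of lists of atoms is both the atomic sequent [l |> r] and
    the partial valuation making the atoms of [l] true and those of [r] false.
    In the calculus without Identity, a derivable sequent refuted by [(l, r)]
    in strong Kleene logic can be decomposed by the elimination rules down to
    [l |> r].  Conversely, every atomic [l |> r] refuting a sequent derivable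
    with Identity either shares an atom between [l] and [r] or is derivable
    without Identity: this is preserved by all rules, Cut being reduced to Cut
    on atoms by induction on the cut formula.  The empty sequent is refuted by
    the empty valuation. *)

(** * Strong Kleene semantics of partial valuations *)

Section PartialValuations.
Variable A : choiceType.
Implicit Types (l r : seq A) (b : bool) (f : form A) (s : sequent A).

(** Strong Kleene evaluation of [f] to the value [b]. The lists [l] and [r] may overlap, so a
    formula can receive both values, or none. *)
Fixpoint forced l r b f : bool :=
  match f with
  | Atom a => a \in if b then l else r
  | And f g => if b then forced l r b f && forced l r b g
               else forced l r b f || forced l r b g
  | Or f g => if b then forced l r b f || forced l r b g
              else forced l r b f && forced l r b g
  | Neg f => forced l r (~~ b) f
  | Top => b
  | Bot => ~~ b
  end.

Definition refuted l r s : Prop :=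
  {in s.1, forall f, forced l r true f} /\ {in s.2, forall f, forced l r false f}.

(** [Neg] flips [b] instead of negating the outcome, so every clause of [forced] is monotone in [l]
    and [r]. *)
Lemma forced_sub l r l' r' b f :
  {subset l <= l'} -> {subset r <= r'} -> forced l r b f -> forced l' r' b f.
Proof.
move=> ll' rr'; elim: f b => [a|f IHf g IHg|f IHf g IHg|f IHf||] //= [] //.
- exact: ll'.
- exact: rr'.
- by case/andP=> /IHf-> /IHg->.
- by case/orP=> [/IHf->|/IHg->]; rewrite ?orbT.
- by case/orP=> [/IHf->|/IHg->]; rewrite ?orbT.
- by case/andP=> /IHf-> /IHg->.
- exact: IHf.
- exact: IHf.
Qed.

Lemma refuted_sub l r l' r' s :
  {subset l <= l'} -> {subset r <= r'} -> refuted l r s -> refuted l' r' s.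
Proof.
move=> ll' rr' [sl sr].
by split=> f fs; apply: forced_sub ll' rr' _; [apply: sl | apply: sr].
Qed.

(** A conflict on a compound formula descends to one of its components, and finally to an atom. *)
Lemma forced_both l r f :
  forced l r true f -> forced l r false f -> has (mem l) r.
Proof.
elim: f => [a|f IHf g IHg|f IHf g IHg|f IHf||] //=.
- by move=> al ar; apply/hasP; exists a.
- by case/andP=> fT gT /orP[/(IHf fT)|/(IHg gT)].
- by case/orP=> [fT|gT] /andP[fF gF]; [apply: IHf | apply: IHg].
- by move=> fF fT; apply: IHf.
Qed.

Lemma refutedDl l r f (G D : {mset form A}) :
  refuted l r (f +` G |> D) <-> forced l r true f /\ refuted l r (G |> D).
Proof.
split=> [[GH DH]|[fH [GH DH]]].
  split; first by apply: GH; rewrite in_mset1D eqxx.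
  by split=> // g gG; apply: GH; rewrite in_mset1D gG orbT.
by split=> // g; rewrite in_mset1D => /orP[/eqP->|/GH].
Qed.

Lemma refutedDr l r f (G D : {mset form A}) :
  refuted l r (G |> f +` D) <-> forced l r false f /\ refuted l r (G |> D).
Proof.
split=> [[GH DH]|[fH [GH DH]]].
  split; first by apply: DH; rewrite in_mset1D eqxx.
  by split=> // g gG; apply: DH; rewrite in_mset1D gG orbT.
by split=> // g; rewrite in_mset1D => /orP[/eqP->|/DH].
Qed.

End PartialValuations.

Lemma mset1D_ind (T : choiceType) (P : {mset T} -> Prop) :
  P mset0 -> (forall x M, P M -> P (x +` M)) -> forall M, P M.
Proof.
move=> P0 PD M; rewrite -(seq_mset_id M).
elim: (M : seq T) => [|x s IHs]; last by rewrite mset_cons; apply: PD.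
have -> // : seq_mset [::] = mset0 :> {mset T}.
by apply/msetP => x; rewrite mset_seqE mset0E.
Qed.

(** * Decomposition of refuted sequents into atomic ones *)

Section EliminationCalculus.
Variables (A : choiceType) (S : sequent A -> Prop).
Implicit Types (l r : seq A) (b : bool) (f : form A) (s : sequent A).
Implicit Types G D : {mset form A}.

Local Notation provable := (derivable (elimination_calculus A) S).

Lemma provable_cut f G D G' D' :
  provable (G |> f +` D) -> provable (f +` G' |> D') ->
  provable (G `+` G' |> D `+` D').
Proof.
move=> p1 p2; apply: derivable_rule (or_introl (Cut G D G' D' f)) _ => p.
by rewrite !inE => /orP[] /eqP->.
Qed.

Lemma provable_weak s c : weakening_rule A [:: s] c -> provable s -> provable c.
Proof.
move=> w sP; apply: (derivable_rule (ps := [:: s])); first by right; left.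
by move=> p; rewrite inE => /eqP->.
Qed.

Lemma provable_contr s c : contraction_rule A [:: s] c -> provable s -> provable c.
Proof.
move=> w sP; apply: (derivable_rule (ps := [:: s])); first by right; right; left.
by move=> p; rewrite inE => /eqP->.
Qed.

Lemma provable_elim s c : elimination_rule A [:: s] c -> provable s -> provable c.
Proof.
move=> w sP; apply: (derivable_rule (ps := [:: s])); first by do 3!right.
by move=> p; rewrite inE => /eqP->.
Qed.

Lemma provable_weakD G D G' D' :
  provable (G |> D) -> provable (G `+` G' |> D `+` D').
Proof.
move=> p; elim/mset1D_ind: G' => [|f G' IHG]; last first.
  by rewrite msetDCA; apply: provable_weak IHG; apply: weakL.
rewrite msetD0; elim/mset1D_ind: D' => [|f D' IHD]; first by rewrite msetD0.
by rewrite msetDCA; apply: provable_weak IHD; apply: weakR.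
Qed.

Definition atoms l : {mset form A} := seq_mset [seq Atom a | a <- l].

Lemma mem_atoms l f : (f \in atoms l) = (f \in [seq Atom a | a <- l]).
Proof. exact: (perm_mem (perm_eq_seq_mset _)). Qed.

Lemma atoms_cons a l : atoms (a :: l) = Atom a +` atoms l.
Proof. exact: mset_cons. Qed.

Lemma refuted_atoms l r : refuted l r (atoms l |> atoms r).
Proof. by split=> f /=; rewrite mem_atoms => /mapP[a al ->]. Qed.

(** The elimination rules break [f] down along its forcing until only atoms already present in the
    context remain, which Contraction removes; constants vanish by their own rules. The contexts are
    arbitrary because one component is absorbed while the other is still there. *)
Lemma provable_absorb l r b f G D :
    {subset atoms l <= G} -> {subset atoms r <= D} -> forced l r b f ->
    provable (if b then f +` G |> D else G |> f +` D) ->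
  provable (G |> D).
Proof.
elim: f b G D => [a|f IHf g IHg|f IHf g IHg|f IHf||] [] G D lG rD //=.
- move=> al; have aG : Atom a \in G by apply: lG; rewrite mem_atoms map_f.
  rewrite -(msetB1K aG); apply: provable_contr; exact: contrL.
- move=> ar; have aD : Atom a \in D by apply: rD; rewrite mem_atoms map_f.
  rewrite -(msetB1K aD); apply: provable_contr; exact: contrR.
- case/andP=> fT gT /(provable_elim (elim_andL _ _ _ _)) p.
  apply: (IHg true) => //; apply: (IHf true) => // x /lG.
  exact: mset1Dr.
- case/orP=> [fF /(provable_elim (elim_andR1 _ _ _ _))|
              gF /(provable_elim (elim_andR2 _ _ _ _))].
    exact: (IHf false).
  exact: (IHg false).
- case/orP=> [fF /(provable_elim (elim_orL1 _ _ _ _))|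
              gF /(provable_elim (elim_orL2 _ _ _ _))].
    exact: (IHf true).
  exact: (IHg true).
- case/andP=> fT gT /(provable_elim (elim_orR _ _ _ _)) p.
  apply: (IHg false) => //; apply: (IHf false) => // x /rD.
  exact: mset1Dr.
- by move=> fF /(provable_elim (elim_negL _ _ _)); apply: (IHf false).
- by move=> fT /(provable_elim (elim_negR _ _ _)); apply: (IHf true).
- by move=> _; apply: provable_elim; apply: elim_topL.
- by move=> _; apply: provable_elim; apply: elim_botR.
Qed.

(** Weakening first adds the atoms of [l] and [r]; then each formula of [s] is absorbed in turn. *)
Lemma provable_refuted l r s :
  provable s -> refuted l r s -> provable (atoms l |> atoms r).
Proof.
case: s => G D /(provable_weakD (atoms l) (atoms r)).
elim/mset1D_ind: G => [|f G IHG]; last first.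
  rewrite -msetDA => p /refutedDl[fT GDr]; apply: IHG => //.
  apply: (@provable_absorb l r true f) p => // x xl.
    by rewrite in_msetD xl orbT.
  by rewrite in_msetD xl orbT.
rewrite mset0D; elim/mset1D_ind: D => [|f D IHD]; first by rewrite mset0D.
rewrite -msetDA => p /refutedDr[fF Dr]; apply: IHD => //.
apply: (@provable_absorb l r false f) p => // x xl.
by rewrite in_msetD xl orbT.
Qed.

(** * Reduction of Cut to Cut on atoms *)

Definition clause l r : Prop := has (mem l) r \/ provable (atoms l |> atoms r).

Lemma clause_sub l r l' r' :
  {subset l <= l'} -> {subset r <= r'} -> clause l r -> clause l' r'.
Proof.
move=> ll' rr' [/hasP[a ar al]|p].
  by left; apply/hasP; exists a; [apply: rr' | apply: ll'].
by right; apply: provable_refuted p (refuted_sub ll' rr' (refuted_atoms _ _)).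
Qed.

(** If a premise holds only because [a] is shared, then [a] already lies in [l] or [r], and the
    other premise has the same atoms as the conclusion. *)
Lemma clause_resolution a l r : clause l (a :: r) -> clause (a :: l) r -> clause l r.
Proof.
have subl (x : A) (t : seq A) : x \in t -> {subset x :: t <= t}.
  by move=> xt y; rewrite inE => /orP[/eqP->|].
case=> [/= /orP[al c|lr]|p1]; [|by move=> _; left|].
  by apply: clause_sub c => //; apply: subl.
case=> [/hasP[x xr]|p2].
  rewrite /= inE => /orP[/eqP xa|xl]; last by left; apply/hasP; exists x.
  rewrite xa in xr; right; apply: provable_refuted p1 _.
  by apply: refuted_sub (refuted_atoms _ _) => //; apply: subl.
right; move: p1 p2; rewrite !atoms_cons => p1 p2.
(* Cut doubles both contexts; the doubled sequent is still refuted by [(l, r)], hence it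
   contracts. *)
apply: provable_refuted (provable_cut p1 p2) _.
have [al ar] := refuted_atoms l r.
by split=> f; rewrite in_msetD orbb; [apply: al | apply: ar].
Qed.

(* Cut on [f], read as: a valuation all of whose extensions deciding [f] are
   clauses is itself a clause. *)
Lemma clause_decide f l r :
    (forall l' r' b, {subset l <= l'} -> {subset r <= r'} ->
       forced l' r' b f -> clause l' r') ->
  clause l r.
Proof.
have mem_c (x : A) t : {subset t <= x :: t}.
  by move=> y yt; rewrite inE yt orbT.
elim: f l r => [a|f IHf g IHg|f IHf g IHg|f IHf||] l r H.
- apply: (@clause_resolution a).
    by apply: (H _ _ false) => //=; rewrite mem_head.
  by apply: (H _ _ true) => //=; rewrite mem_head.
(* A false [f] already decides the conjunction. A true [f] stays true in the extensions that decide
   [g]. *)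
- apply: IHf => l1 r1 [] ll1 rr1 fb; last first.
    by apply: (H _ _ false) => //=; rewrite fb.
  apply: IHg => l2 r2 [] l12 r12 gb.
    apply: (H _ _ true) => /=; [by move=> x /ll1/l12 | by move=> x /rr1/r12 |].
    by rewrite gb (forced_sub l12 r12 fb).
  apply: (H _ _ false) => /=; [by move=> x /ll1/l12 | by move=> x /rr1/r12 |].
  by rewrite gb orbT.
- apply: IHf => l1 r1 [] ll1 rr1 fb.
    by apply: (H _ _ true) => //=; rewrite fb.
  apply: IHg => l2 r2 [] l12 r12 gb.
    apply: (H _ _ true) => /=; [by move=> x /ll1/l12 | by move=> x /rr1/r12 |].
    by rewrite gb orbT.
  apply: (H _ _ false) => /=; [by move=> x /ll1/l12 | by move=> x /rr1/r12 |].
  by rewrite gb (forced_sub l12 r12 fb).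
- apply: IHf => l1 r1 b ll1 rr1 fb; apply: (H _ _ (~~ b)) => //=.
  by rewrite negbK.
- exact: (H _ _ true).
- exact: (H _ _ false).
Qed.

(** Refutations travel upwards, from the conclusion to a premise. Cut may violate this, as the
    valuation can leave the cut formula undecided. *)
Definition refutation_sound (R : rule A) : Prop :=
  forall ps c l r, R ps c -> refuted l r c -> exists2 s, s \in ps & refuted l r s.

Lemma refuted_weak : refutation_sound (weakening_rule A).
Proof.
move=> ps c l r [] G D f.
  by case/refutedDl => _ ref; exists (G |> D); rewrite ?mem_head.
by case/refutedDr => _ ref; exists (G |> D); rewrite ?mem_head.
Qed.

Lemma refuted_contr : refutation_sound (contraction_rule A).
Proof.
move=> ps c l r [] G D f ref; (eexists; first exact: mem_head).
  by apply/refutedDl; split=> //; case/refutedDl: ref.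
by apply/refutedDr; split=> //; case/refutedDr: ref.
Qed.

Lemma refuted_elim : refutation_sound (elimination_rule A).
Proof.
move=> ps c l r [] G D => [f g|f g|f g|f g|f g|f g|f|f||] ref;
  (eexists; first exact: mem_head).
- by case/refutedDr: ref => fF ref; apply/refutedDr; rewrite /= fF.
- by case/refutedDr: ref => fF ref; apply/refutedDr; rewrite /= fF orbT.
- by case/refutedDl: ref => fT /refutedDl[gT ref]; apply/refutedDl; rewrite /= fT.
- by case/refutedDl: ref => fT ref; apply/refutedDl; rewrite /= fT.
- by case/refutedDl: ref => fT ref; apply/refutedDl; rewrite /= fT orbT.
- by case/refutedDr: ref => fF /refutedDr[gF ref]; apply/refutedDr; rewrite /= fF.
- by case/refutedDl: ref => fT ref; apply/refutedDr.
- by case/refutedDr: ref => fF ref; apply/refutedDl.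
- by apply/refutedDl.
- by apply/refutedDr.
Qed.

Lemma derivable_identity_clause s l r :
    derivable (rule_union (elimination_calculus A) (identity_rule A)) S s ->
  refuted l r s -> clause l r.
Proof.
move=> ds; elim: ds l r => {s} [s Ss|ps c Rc _ IH] l r ref.
  by right; apply: provable_refuted ref; apply: derivable_hyp.
case: Rc ref IH => [[|[|[]]]|].
(* Once [f] is decided, a true [f] refutes the right premise of the Cut and a false [f] the left
   one. *)
- case=> G D G' D' f [GT DF] IH; apply: (@clause_decide f) => l' r' b ll' rr' fb.
  have {GT DF} [GT DF] := refuted_sub ll' rr' (conj GT DF).
  case: b fb => fb.
    apply: (IH (f +` G' |> D')); first by rewrite !inE eqxx orbT.
    apply/refutedDl; split=> //.
    by split=> g gG; [apply: GT | apply: DF]; rewrite in_msetD gG orbT.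
  apply: (IH (G |> f +` D)); first by rewrite !inE eqxx.
  apply/refutedDr; split=> //.
  by split=> g gG; [apply: GT | apply: DF]; rewrite in_msetD gG.
- by move=> /refuted_weak R /R[s sps sr] IH; apply: IH sr.
- by move=> /refuted_contr R /R[s sps sr] IH; apply: IH sr.
- by move=> /refuted_elim R /R[s sps sr] IH; apply: IH sr.
(* A refuted Identity axiom forces [f] both true and false. *)
- by case=> f [fT fF] _; left; apply: (@forced_both _ _ _ f);
    [apply: fT | apply: fF]; rewrite /= in_mset1.
Qed.

End EliminationCalculus.

Theorem theorem3p10 (A : choiceType) :
  antiadmissible (identity_rule A) (elimination_calculus A).
Proof.
move=> S d; have atoms0 : atoms [::] = mset0 :> {mset form A}.
  by apply/msetP => f; rewrite mset_seqE mset0E.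
have ref0 : refuted [::] [::] (empty_sequent A).
  by rewrite /empty_sequent -atoms0; apply: refuted_atoms.
(* Empty lists share no atom, so only derivability is left. *)
by case: (derivable_identity_clause d ref0) => //; rewrite atoms0.
Qed.
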